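(* The Boolean lattice $\mathcal{B}_7$ of order $7$ satisfies $\operatorname{ldim}(\mathcal{B}_7)\leq 5$.
   Context: A poset is a pair $P=(X,\leq)$ where $X$ is a non-empty set and $\leq$ is a reflexive, antisymmetric, transitive relation on $X$. A poset $Q$ is a subposet of $P$ if the ground set of $Q$ is a subset of that of $P$ and the order of $Q$ is the restriction of the order of $P$. A linear extension of $P$ is a linear order $L$ on the ground set of $P$ such that $x\leq_L y$ whenever $x\leq_P y$. A partial linear extension of $P$ is a linear extension of a subposet of $P$. A local realizer of $P$ is a family $\mathcal{L}$ of partial linear extensions of $P$ such that for all $x,y\in P$ there exists $L\in\mathcal{L}$ with $x,y\in L$, and $x\leq_P y$ if and only if there is no $L\in\mathcal{L}$ with $y<_L x$. The frequency of an element $x\in P$ in $\mathcal{L}$ is the number of $L\in\mathcal{L}$ with $x\in L$ (i.e. $x$ is in the ground set of $L$); the frequency of $\mathcal{L}$ is the maximum frequency of an element of $P$ in $\mathcal{L}$. The local dimension $\operatorname{ldim}(P)$ is the minimum frequency of a local realizer of $P$. For a positive integer $n$, the Boolean lattice $\mathcal{B}_n$ is the poset of all subsets of $[n]=\{1,\dots,n\}$ ordered by inclusion. *)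

(* Defs.v *)
From HB Require Import structures.
From mathcomp Require Import all_boot all_order.

Set Implicit Arguments.
Unset Strict Implicit.
Unset Printing Implicit Defensive.

Import Order.Theory.

Section LocalDimension.

Variables (d : Order.disp_t) (P : finPOrderType d).

Definition linear_order_on (A : {set P}) (R : {set P * P}) : bool :=
  [&& R \subset setX A A,
      [forall x in A, (x, x) \in R],
      [forall x, forall y, ((x, y) \in R) && ((y, x) \in R) ==> (x == y)],
      [forall x, forall y, forall z,
         ((x, y) \in R) && ((y, z) \in R) ==> ((x, z) \in R)]
    & [forall x in A, forall y in A, ((x, y) \in R) || ((y, x) \in R)]].

(* R is a linear extension of the subposet of P with ground set A. *)
Definition is_ple (A : {set P}) (R : {set P * P}) : bool :=
  [&& A != set0, linear_order_on A R
    & [forall x in A, forall y in A, (x <= y)%O ==> ((x, y) \in R)]].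

Record ple : Type := Ple {
  ple_pair : {set P} * {set P * P};
  ple_pairP : is_ple ple_pair.1 ple_pair.2
}.

HB.instance Definition _ := [isSub for ple_pair].
HB.instance Definition _ := [Finite of ple by <:].

Definition ground (L : ple) : {set P} := (ple_pair L).1.

Definition ple_le (L : ple) : rel P := fun x y => (x, y) \in (ple_pair L).2.

Definition ple_lt (L : ple) : rel P := fun x y => (x != y) && ple_le L x y.

(* P is finite and ground sets are non-empty, so any family of ples with finite
   frequency is finite; repeated members never lower the frequency, hence
   families are taken to be sets. *)
Definition local_realizer (F : {set ple}) : bool :=
  [forall x : P, forall y : P,
    [exists L in F, (x \in ground L) && (y \in ground L)] &&
    ((x <= y)%O == ~~ [exists L in F, ple_lt L y x])].

Definition element_frequency (F : {set ple}) (x : P) : nat :=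
  #|[set L in F | x \in ground L]|.

Definition frequency (F : {set ple}) : nat := \max_(x : P) element_frequency F x.

(* The chain y <= x on the ground set {x, y} is a ple unless x < y, so the
   family of all ples of P is a local realizer. *)
Definition chain2 (x y : P) : {set P} * {set P * P} :=
  ([set x; y], [set (x, x); (y, y); (y, x)]).

Lemma chain2_ple (x y : P) : ~~ (x < y)%O -> is_ple (chain2 x y).1 (chain2 x y).2.
Proof.
move=> nxy; have le1 u v : u \in [set x; y] -> v \in [set x; y] ->
    (u <= v)%O -> (u, v) \in [set (x, x); (y, y); (y, x)].
  rewrite !inE !xpair_eqE => /orP[]/eqP-> /orP[]/eqP->; rewrite ?eqxx ?orbT //.
  by rewrite le_eqVlt (negbTE nxy) orbF => /eqP->; rewrite eqxx.
apply/and3P; split.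
- by apply/set0Pn; exists x; rewrite !inE eqxx.
- apply/and5P; split.
  + apply/subsetP=> -[u v]; rewrite !inE !xpair_eqE /=.
    by case/orP=> [/orP[]|] /andP[/eqP-> /eqP->]; rewrite !eqxx ?orbT.
  + by apply/forall_inP=> u uA; apply: le1.
  + apply/forallP=> u; apply/forallP=> v; apply/implyP.
    rewrite !inE !xpair_eqE => /andP[].
    by case/orP=> [/orP[]|] /andP[/eqP-> /eqP->];
      case/orP=> [/orP[]|] /andP[/eqP e1 /eqP e2]; apply/eqP; congruence.
  + apply/forallP=> u; apply/forallP=> v; apply/forallP=> w; apply/implyP.
    rewrite !inE !xpair_eqE => /andP[].
    case/orP=> [/orP[]|] /andP[/eqP-> /eqP->];
      case/orP=> [/orP[]|] /andP[/eqP e1 /eqP->];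
      rewrite ?eqxx ?orbT //; by rewrite e1 ?eqxx ?orbT.
  + apply/forall_inP=> u; rewrite !inE => uA; apply/forall_inP=> v; move: uA.
    by rewrite !inE !xpair_eqE => /orP[]/eqP-> /orP[]/eqP->; rewrite !eqxx ?orbT.
- by apply/forall_inP=> u uA; apply/forall_inP=> v vA; apply/implyP; apply: le1.
Qed.

Lemma local_realizer_setT : local_realizer setT.
Proof.
apply/forallP=> x; apply/forallP=> y; apply/andP; split.
  case: (boolP (x < y)%O) => [lxy | nxy].
    have nyx : ~~ (y < x)%O by rewrite lt_gtF.
    apply/existsP; exists (Ple (chain2_ple nyx)).
    by rewrite /ground /= !inE !eqxx ?orbT.
  apply/existsP; exists (Ple (chain2_ple nxy)).
  by rewrite /ground /= !inE !eqxx ?orbT.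
apply/eqP; case: (boolP (x <= y)%O) => [lxy | nxy]; apply/esym.
  apply/existsPn=> L; rewrite inE /=; apply/negP=> /andP[nyx]; rewrite /ple_le => Lyx.
  have /and3P[_ /and5P[/subsetP sA _ /forallP/(_ x)/forallP/(_ y) + _ _]] :=
    ple_pairP L.
  move=> anti /forall_inP ext; have := sA _ Lyx; rewrite inE /= => /andP[yA xA].
  move: (ext _ xA) => /forall_inP/(_ _ yA); rewrite lxy /= => Lxy.
  by move: anti; rewrite Lxy Lyx /= eq_sym (negbTE nyx).
have nxy' : ~~ (x < y)%O by apply: contra nxy; apply: ltW.
apply/negbTE; rewrite negbK; apply/existsP; exists (Ple (chain2_ple nxy')).
rewrite /ple_lt /ple_le /= !inE eqxx !orbT andbT.
by apply: contraNneq nxy => ->.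
Qed.

Lemma ldim_exists :
  exists k, [exists F : {set ple}, local_realizer F && (frequency F == k)].
Proof.
exists (frequency setT); apply/existsP; exists setT.
by rewrite local_realizer_setT eqxx.
Qed.

(* ex_minn returns the least k such that some local realizer has frequency k. *)
Definition ldim : nat := ex_minn ldim_exists.

End LocalDimension.

Arguments ldim {d} P.

Import Order.DefaultSetSubsetOrder.

(* 'I_n stands for [n] = {1, ..., n}; the order on {set 'I_n} is \subset. *)
Definition boolean_lattice (n : nat) : finPOrderType _ := {set 'I_n}.

Lemma boolean_latticeE (n : nat) (A B : boolean_lattice n) :
  (A <= B)%O = ((A : {set 'I_n}) \subset B).
Proof. by []. Qed.

(* Main.v *)
Require Import Defs.
From mathcomp Require Import all_boot all_order.

Set Implicit Arguments.
Unset Strict Implicit.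
Unset Printing Implicit Defensive.

Import Order.Theory.

(** Seven partial linear extensions suffice, arranged so that every set takes
part in exactly five of them.  They are the translates, under the rotations
[j |-> j + i] of Z/7, of a single linear order [base_chain] on 90 subsets.

The rotations act freely on the 126 subsets other than the empty and the full
set, because 7 is prime: there are 18 orbits of size 7.  The base chain keeps
five members of each orbit, and a set [A] occurs in the [i]-th translate
exactly when its rotate [A - i] occurs in the base chain, so [A] has frequency
five.  The two sets fixed by all rotations are added at the bottom and at the
top of five of the translates.  Any two sets then occur together at least three
times, since two 5-subsets of a 7-element set meet in three points or more.
What remains is that for incomparable [A] and [B] some translate contains both
and places [A] above [B]; by the symmetry this says that some common rotate of
the pair [(A, B)] lies in the base chain in that order.  There are 1734 orbits
of such pairs, and each of them has about 25/7 chances on average to lie in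
the chain, in one of the two orders, which leaves enough room for a chain that
serves them all.  The base chain itself is the outcome of a randomized search,
and its properties are verified by computation.

[ldim_le_seqs] turns a family of lists into a local realizer, and
[ldim_boolean_le] reduces its hypotheses for a Boolean lattice to a boolean
test on sequences of bits, which is evaluated for the seven translates. *)

(** * Local realizers from lists *)

Section SequenceFamilies.

Variables (d : Order.disp_t) (P : finPOrderType d).
Implicit Types (x y : P) (s : seq P) (ss : seq (seq P)).

(** No list of this kind has repetitions, by reflexivity, so its order of
occurrence is a linear extension of the induced subposet. *)
Definition increasing s : bool := pairwise (fun x y => ~~ (y <= x)%O) s.

Definition ple_data s : {set P} * {set P * P} :=
  ([set x in s],
   [set u | [&& u.1 \in s, u.2 \in s & index u.1 s <= index u.2 s]]).

Lemma increasing_index s x y :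
  increasing s -> x \in s -> y \in s -> (x <= y)%O -> index x s <= index y s.
Proof.
move=> inc_s xs ys le_xy; rewrite leqNgt; apply/negP=> lt_yx.
have /(pairwiseP x)/(_ (index y s) (index x s)) := inc_s.
by rewrite !inE !index_mem !nth_index // le_xy => /(_ ys xs lt_yx).
Qed.

Lemma ple_data_is_ple s :
  s != [::] -> increasing s -> is_ple (ple_data s).1 (ple_data s).2.
Proof.
move=> s_neq0 inc_s; apply/and3P; split.
- case: s s_neq0 {inc_s} => // x s _.
  by apply/set0Pn; exists x; rewrite inE mem_head.
- apply/and5P; split.
  + by apply/subsetP=> -[x y]; rewrite !inE /= => /and3P[-> ->].
  + by apply/forall_inP=> x; rewrite !inE /= leqnn andbT => ->.
  + apply/forallP=> x; apply/forallP=> y; apply/implyP; rewrite !inE /=.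
    move=> /andP[/and3P[xs ys le_xy] /and3P[_ _ le_yx]].
    by apply/eqP/(index_inj x xs ys)/eqP; rewrite /= eqn_leq le_xy.
  + apply/forallP=> x; apply/forallP=> y; apply/forallP=> z; apply/implyP.
    rewrite !inE /= => /andP[/and3P[-> ys le_xy] /and3P[_ -> le_yz]] /=.
    exact: leq_trans le_yz.
  + apply/forall_inP=> x; rewrite inE => xs; apply/forall_inP=> y.
    by rewrite inE => ys; rewrite !inE /= xs ys leq_total.
- apply/forall_inP=> x; rewrite inE => xs; apply/forall_inP=> y.
  rewrite inE => ys; apply/implyP=> le_xy; rewrite !inE /= xs ys.
  exact: increasing_index.
Qed.

(** The second hypothesis merges the two clauses in the definition of a local
realizer: if [x <= y] it only asks that [x] and [y] meet in some list, and
otherwise that some list puts [y] strictly before [x].  No list can put [y]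
before [x] when [x <= y], so the lists do realize the order.  Distinct lists
may give the same partial linear extension, which can only lower the
frequencies. *)
Lemma ldim_le_seqs k ss :
    all increasing ss ->
    (forall x y, has (fun s => [&& x \in s, y \in s
                         & (x <= y)%O || (index y s < index x s)]) ss) ->
    (forall x, count (fun s => x \in s) ss <= k) ->
  ldim P <= k.
Proof.
move=> /allP inc_ss covers freq_le.
pose F := [set L : ple P | val L \in [seq ple_data s | s <- ss]].
have ple_in s x : s \in ss -> x \in s ->
    exists2 L : ple P, L \in F & ple_pair L = ple_data s.
  move=> s_ss xs; have s_neq0 : s != [::] by apply: contraTneq xs => ->.
  exists (Ple (ple_data_is_ple s_neq0 (inc_ss s s_ss))) => //.
  by rewrite inE; apply/mapP; exists s.
have F_realizer : local_realizer F.
  apply/forallP=> x; apply/forallP=> y; apply/andP; split.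
    have /hasP[s s_ss /and3P[xs ys _]] := covers x y.
    have [L FL defL] := ple_in s x s_ss xs.
    by apply/existsP; exists L; rewrite FL /ground defL !inE xs ys.
  apply/eqP; case: (boolP (x <= y)%O) => le_xy; apply/esym.
    apply/existsPn=> L; rewrite inE; apply/negP=> /andP[/mapP[s s_ss defL]].
    rewrite /ple_lt /ple_le [ple_pair L]defL inE /=.
    move=> /and4P[neq_yx ys xs le_yx].
    have le_xy' := increasing_index (inc_ss s s_ss) xs ys le_xy.
    case/eqP: neq_yx; apply/(index_inj x ys xs)/eqP.
    by rewrite /= eqn_leq le_yx.
  apply/negbTE; rewrite negbK.
  have /hasP[s s_ss /and3P[xs ys]] := covers x y.
  rewrite (negbTE le_xy) /= => lt_yx.
  have [L FL defL] := ple_in s x s_ss xs.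
  apply/existsP; exists L; rewrite FL /ple_lt /ple_le defL inE /= xs ys.
  by rewrite (ltnW lt_yx) /= andbT; apply: contraTneq lt_yx => ->; rewrite ltnn.
have F_freq : frequency F <= k.
  apply/bigmax_leqP=> x _; apply: leq_trans (freq_le x).
  rewrite /element_frequency -(card_imset _ val_inj) -size_filter.
  rewrite -(size_map (@ple_data) [seq s <- ss | x \in s]).
  apply: leq_trans (card_size _); apply/subset_leq_card/subsetP=> u.
  case/imsetP=> L; rewrite !inE => /andP[/mapP[s s_ss defL] xL] ->.
  rewrite defL map_f // mem_filter s_ss andbT.
  by move: xL; rewrite /ground [ple_pair L]defL inE.
rewrite /ldim; case: ex_minnP => m _ m_min.
apply: leq_trans F_freq; apply: m_min.
by apply/existsP; exists F; rewrite F_realizer eqxx.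
Qed.

End SequenceFamilies.

(** * Subsets of [{0, ..., n - 1}] as bit sequences *)

Section Codes.

Variable n : nat.
Implicit Types A B : boolean_lattice n.

(** Finite sets do not compute; their characteristic sequences do. *)
Definition code A : bitseq := [seq i \in A | i <- enum 'I_n].

Definition list_bits (l : seq nat) : bitseq := [seq i \in l | i <- iota 0 n].

Definition list_set (l : seq nat) : boolean_lattice n :=
  [set i : 'I_n | val i \in l].

Fixpoint cube (m : nat) : seq bitseq :=
  if m is m'.+1 then
    [seq false :: b | b <- cube m'] ++ [seq true :: b | b <- cube m']
  else [:: [::]].

Lemma mem_cube (b : bitseq) : b \in cube (size b).
Proof.
by elim: b => // -[] b IHb; rewrite mem_cat (map_f _ IHb) ?orbT.
Qed.

Lemma code_in_cube A : code A \in cube n.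
Proof. by have := mem_cube (code A); rewrite size_map size_enum_ord. Qed.

Lemma code_inj : injective code.
Proof.
move=> A B /eq_in_map eqAB; apply/setP=> i.
by apply: eqAB; rewrite mem_enum.
Qed.

Lemma code_list_set l : code (list_set l) = list_bits l.
Proof.
rewrite /list_bits -val_enum_ord -[RHS]map_comp.
by apply: eq_map => i; rewrite /= inE.
Qed.

Definition bits_sub (b c : bitseq) : bool := all2 implb b c.

Lemma code_sub A B : (A <= B)%O = bits_sub (code A) (code B).
Proof.
rewrite boolean_latticeE /bits_sub /code; apply/subsetP/idP => [sAB | ].
  by elim: (enum _) => //= i e ->; rewrite andbT; apply/implyP/sAB.
move=> sAB i; apply/implyP; have := mem_enum 'I_n i.
elim: (enum _) sAB => //= j e IHe /andP[ijAB /IHe{}IHe].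
by rewrite in_cons => /predU1P[->|/IHe].
Qed.

End Codes.

(** * A computable test *)

(** Here [i] and [j] are the positions of [A] and [B] in a list of size [m],
where a position equal to [m] means absence, and [sub] tells whether [A] is
contained in [B].  If it is not, [j < i < m] says at once that both sets are
present and that [A] comes after [B]. *)
Definition separates (sub : bool) (m i j : nat) : bool :=
  if sub then (i < m) && (j < m) else j < i < m.

Fixpoint separated (sub : bool) (sizes ps qs : seq nat) : bool :=
  match sizes, ps, qs with
  | m :: sizes', i :: ps', j :: qs' =>
      separates sub m i j || separated sub sizes' ps' qs'
  | _, _, _ => false
  end.

Definition positions (ss : seq (seq bitseq)) (b : bitseq) : seq nat :=
  [seq index b s | s <- ss].

Lemma separated_positions sub ss b c :
  separated sub [seq size s | s <- ss] (positions ss b) (positions ss c)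
    = has (fun s => separates sub (size s) (index b s) (index c s)) ss.
Proof. by elim: ss => //= s ss ->. Qed.

(** The positions of each set are tabulated once, so that testing all pairs
needs no search in the lists. *)
Definition covering (ss : seq (seq bitseq)) (bs : seq bitseq) : bool :=
  let sizes := [seq size s | s <- ss] in
  let table := [seq (b, positions ss b) | b <- bs] in
  all (fun u => all (fun v => separated (bits_sub u.1 v.1) sizes u.2 v.2) table)
    table.

Lemma coveringP ss bs b c :
    covering ss bs -> b \in bs -> c \in bs ->
  has (fun s => separates (bits_sub b c) (size s) (index b s) (index c s)) ss.
Proof.
rewrite /covering all_map => /allP cov b_bs c_bs.
have := cov b b_bs; rewrite /= all_map => /allP/(_ c c_bs) /=.
by rewrite separated_positions.
Qed.

Definition certificate (n k : nat) (ss : seq (seq bitseq)) : bool :=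
  [&& all (pairwise (fun b c => ~~ bits_sub c b)) ss, covering ss (cube n)
    & all (fun b => count (fun s => b \in s) ss <= k) (cube n)].

Lemma ldim_boolean_le n k (ls : seq (seq (seq nat))) :
  certificate n k [seq [seq list_bits n l | l <- s] | s <- ls] ->
  ldim (boolean_lattice n) <= k.
Proof.
set ss := map _ ls => /and3P[inc_ss cov /allP freq_le].
pose Ls := [seq [seq list_set n l | l <- s] | s <- ls].
have codeLs : ss = [seq [seq code A | A <- s] | s <- Ls].
  rewrite /ss -map_comp; apply: eq_map => s /=; rewrite -map_comp.
  by apply: eq_map => l /=; rewrite code_list_set.
have mem_code A (s : seq (boolean_lattice n)) :
    (code A \in [seq code B | B <- s]) = (A \in s).
  exact: mem_map (@code_inj n) s A.
apply: (@ldim_le_seqs _ _ k Ls) => [|A B|A].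
- move: inc_ss; rewrite codeLs all_map; apply: sub_all => s /=.
  by rewrite pairwise_map; apply: sub_pairwise => A B /=; rewrite code_sub.
- have := coveringP cov (code_in_cube A) (code_in_cube B).
  rewrite codeLs has_map; apply: sub_has => s /=.
  rewrite /separates size_map !(index_map (@code_inj n)) -code_sub -!index_mem.
  case: (A <= B)%O => /= [/andP[-> ->] // | /andP[lt_BA ltA]].
  by rewrite ltA lt_BA (ltn_trans lt_BA ltA).
- have := freq_le _ (code_in_cube A); rewrite codeLs count_map.
  by congr (_ <= k); apply: eq_count => s /=; rewrite mem_code.
Qed.

(** * The seven translates *)

(** Listed from bottom to top, each set by its elements in [{0, ..., 6}]. *)
Definition base_chain : seq (seq nat) :=
  [::
    [:: 2]; [:: 2; 5]; [:: 4]; [:: 3; 5]; [:: 4; 5]; [:: 2; 4; 5]; [:: 0];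
    [:: 2; 3; 4]; [:: 0; 2]; [:: 0; 2; 4]; [:: 0; 3; 4]; [:: 0; 2; 5];
    [:: 0; 4; 5]; [:: 0; 2; 4; 5]; [:: 3; 4; 5]; [:: 2; 3; 4; 5];
    [:: 0; 3; 4; 5]; [:: 0; 2; 3; 4]; [:: 1]; [:: 0; 2; 3; 4; 5]; [:: 1; 3];
    [:: 1; 5]; [:: 0; 1]; [:: 1; 2]; [:: 1; 4]; [:: 1; 2; 4]; [:: 1; 3; 4];
    [:: 0; 1; 3]; [:: 1; 2; 3; 4]; [:: 0; 1; 5]; [:: 1; 3; 5];
    [:: 0; 1; 3; 5]; [:: 0; 1; 4]; [:: 1; 4; 5]; [:: 0; 1; 3; 4];
    [:: 0; 1; 2; 4]; [:: 0; 1; 2; 3; 4]; [:: 1; 2; 4; 5]; [:: 0; 1; 2; 3; 5];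
    [:: 1; 3; 4; 5]; [:: 0; 1; 4; 5]; [:: 0; 1; 3; 4; 5]; [:: 1; 2; 3; 4; 5];
    [:: 0; 1; 2; 4; 5]; [:: 0; 1; 2; 3; 4; 5]; [:: 6]; [:: 5; 6]; [:: 2; 6];
    [:: 0; 6]; [:: 4; 6]; [:: 0; 4; 6]; [:: 1; 6]; [:: 1; 5; 6]; [:: 1; 4; 6];
    [:: 0; 1; 6]; [:: 0; 1; 4; 6]; [:: 1; 2; 4; 6]; [:: 0; 5; 6];
    [:: 0; 1; 5; 6]; [:: 4; 5; 6]; [:: 2; 4; 5; 6]; [:: 0; 1; 2; 4; 6];
    [:: 1; 2; 5; 6]; [:: 0; 1; 2; 5; 6]; [:: 0; 4; 5; 6]; [:: 1; 4; 5; 6];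
    [:: 0; 1; 4; 5; 6]; [:: 1; 2; 4; 5; 6]; [:: 3; 6]; [:: 0; 1; 2; 4; 5; 6];
    [:: 0; 3; 6]; [:: 3; 5; 6]; [:: 0; 3; 5; 6]; [:: 1; 3; 6]; [:: 3; 4; 6];
    [:: 1; 3; 5; 6]; [:: 1; 3; 4; 6]; [:: 2; 3; 6]; [:: 2; 3; 4; 6];
    [:: 0; 1; 3; 6]; [:: 3; 4; 5; 6]; [:: 1; 3; 4; 5; 6]; [:: 1; 2; 3; 5; 6];
    [:: 1; 2; 3; 4; 5; 6]; [:: 0; 3; 4; 6]; [:: 0; 3; 4; 5; 6];
    [:: 0; 1; 3; 5; 6]; [:: 0; 1; 3; 4; 6]; [:: 0; 1; 2; 3; 4; 6];
    [:: 0; 2; 3; 4; 5; 6]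
  ].

Definition translate (i : nat) : seq (seq nat) :=
  [seq [seq (j + i) %% 7 | j <- l] | l <- base_chain].

(** Any choice of five of the seven translates would do for the empty and the
full set. *)
Definition chains : seq (seq (seq nat)) :=
  mkseq (fun i => if i < 5 then [::] :: rcons (translate i) (iota 0 7)
                  else translate i) 7.

Theorem lemma8 : ldim (boolean_lattice 7) <= 5.
Proof. by apply: (@ldim_boolean_le 7 5 chains); vm_compute. Qed.
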